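(* For every integer $n\geq 1$ there are integers $\gamma^S_{n,k}$, $0\le k\le\lfloor (n-1)/2\rfloor$, such that $$S_n(t):=\sum_{\pi\in\mathfrak{S}_n(2413,3142)}t^{\mathrm{des}(\pi)}=\sum_{k=0}^{\lfloor\frac{n-1}{2}\rfloor}\gamma_{n,k}^S\, t^k (1+t)^{n-1-2k},$$ where $$\gamma_{n,k}^S=\#\{\pi \in \mathfrak{S}_n(3142, 2413): \mathrm{dd}(\pi)=0,\ \mathrm{des}(\pi)=k\}.$$ In particular, the polynomial $S_n(t)$ is $\gamma$-positive for $n\geq 1$, and hence palindromic and unimodal.
   Context: $\mathfrak{S}_n$ is the set of permutations of $[n]=\{1,\dots,n\}$, written in one-line notation $\pi=\pi_1\cdots\pi_n$. A permutation $\pi$ contains a pattern $\sigma$ if some (not necessarily consecutive) subsequence of $\pi$ has the same relative order as $\sigma$; otherwise it avoids $\sigma$. $\mathfrak{S}_n(2413,3142)$ is the set of permutations in $\mathfrak{S}_n$ avoiding both $2413$ and $3142$ (separable permutations). With the convention $\pi_0=\pi_{n+1}=+\infty$, an index $i\in[n]$ is a descent if $\pi_i>\pi_{i+1}$ and a double descent if $\pi_{i-1}>\pi_i>\pi_{i+1}$; $\mathrm{des}(\pi)$ and $\mathrm{dd}(\pi)$ denote the numbers of descents and double descents. A polynomial is $\gamma$-positive of darga $m$ if it can be written as $\sum_k \gamma_k t^k(1+t)^{m-2k}$ with all $\gamma_k\ge 0$. A polynomial $\sum h_it^i$ is unimodal if $h_0\le\cdots\le h_c\ge h_{c+1}\ge\cdots$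 for some $c$. *)

(* Defs.v *)
From mathcomp Require Import all_boot all_order all_algebra all_fingroup.
Set Implicit Arguments. Unset Strict Implicit. Unset Printing Implicit Defensive.
Import GRing.Theory Num.Theory.

(* Permutations of [n] are represented by 'S_n (permutations of 'I_n = {0..n-1});
   the one-line value pi_i (1 <= i <= n) is (pi (i-1)).+1. *)

Definition contains_pat n (pi : 'S_n) (sig : seq nat) : bool :=
  [exists f : {ffun 'I_(size sig) -> 'I_n},
    [forall a : 'I_(size sig), forall b : 'I_(size sig),
       ((a < b)%N ==> (f a < f b)%N) &&
       (((pi (f a)) < (pi (f b)))%N == (nth 0 sig a < nth 0 sig b)%N)]].

Definition avoids_pat n (pi : 'S_n) (sig : seq nat) : bool := ~~ contains_pat pi sig.

Definition separable_perms n : {set 'S_n} :=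
  [set pi : 'S_n | avoids_pat pi [:: 2; 4; 1; 3] && avoids_pat pi [:: 3; 1; 4; 2]].

(* pi_i for 0 <= i <= n+1 with pi_0 = pi_{n+1} = +infinity (encoded as n+1,
   larger than every value 1..n). *)
Definition pval n (pi : 'S_n) (i : nat) : nat :=
  if i is i'.+1 then nth n.+1 [seq (pi j).+1 | j <- enum 'I_n] i' else n.+1.

Definition des n (pi : 'S_n) : nat :=
  count (fun i => pval pi i.+1 < pval pi i)%N (iota 1 n).

Definition dd n (pi : 'S_n) : nat :=
  count (fun i => (pval pi i.+1 < pval pi i) && (pval pi i < pval pi i.-1))%N (iota 1 n).

Local Open Scope ring_scope.

Definition Spoly n : {poly int} := \sum_(pi in separable_perms n) 'X^(des pi).

Definition gammaS n k : nat :=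
  #|[set pi in separable_perms n | (dd pi == 0%N) && (des pi == k)]|.

Definition gamma_positive (p : {poly int}) (m : nat) : Prop :=
  exists g : nat -> int, (forall k, 0 <= g k) /\
    p = \sum_(k < m./2.+1) g k *: ('X^k * (1 + 'X) ^+ (m - 2 * k)).

Definition palindromic (p : {poly int}) (m : nat) : Prop :=
  (size p <= m.+1)%N /\ forall i, (i <= m)%N -> p`_i = p`_(m - i).

Definition unimodal (p : {poly int}) : Prop :=
  exists c : nat, (forall i, (i < c)%N -> p`_i <= p`_i.+1) /\
                  (forall i, (c <= i)%N -> p`_i.+1 <= p`_i).

(* Main.v *)
(** Weigh every letter of a permutation (with the convention pi_0 = pi_(n+1) = +oo) by 1, t,
    a or b according as it is a valley, a peak, a double ascent or a double descent.  A
    separable permutation of size at least 2 is either a direct or a skew sum, and not both.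
    Cutting it at the first possible place expresses the generating functions s, p, q, r of
    separable permutations, for the four conventions +oo / -oo at the two ends, through
    those of the indecomposable ones.  Eliminating from this system all series but s leaves
      s = z (1 + (a + b) s + t s^2) + t s^3,
    where z marks the size: s depends on a and b only through a + b.  The choice
    (a, b) = (1, t) gives S_n(t), while (a, b) = (1 + t, 0) gives the gamma-expansion.  *)
Require Import Defs.
From mathcomp Require Import all_boot all_order all_algebra all_fingroup.
From mathcomp Require Import ring zify.
Set Implicit Arguments. Unset Strict Implicit. Unset Printing Implicit Defensive.
Import GRing.Theory Num.Theory.

(** * Separable words *)

Section Words.
Implicit Types (r : rel nat) (w : seq nat) (k n : nat).

(* Avoidance of 3142 for [r := ltn], of 2413 for [r := gtn]. *)
Definition avoids4 r w : bool :=
  [forall m : (size w).-tuple bool,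
    if mask m w is [:: a; b; c; d] then ~~ [&& r b d, r d a & r a c] else true].

Lemma avoids4P r w :
  reflect (forall a b c d, subseq [:: a; b; c; d] w -> ~~ [&& r b d, r d a & r a c])
          (avoids4 r w).
Proof.
apply: (iffP forallP) => [av a b c d /subseqP[m /eqP sm mw] | av m].
  by have := av (Tuple sm); rewrite /= -mw.
case mE: (mask m w) => [|a [|b [|c [|d [|e s]]]]] //.
by apply: av; rewrite -mE mask_subseq.
Qed.

Lemma avoids4_subseq r w w' : subseq w' w -> avoids4 r w -> avoids4 r w'.
Proof.
move=> sw /avoids4P av; apply/avoids4P => a b c d s4.
by apply: av; apply: subseq_trans sw.
Qed.

(** Two relations are allowed so that an order-reversing [f], such as complementation, exchanges
    [ltn] with [gtn] and hence the two patterns. *)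
Lemma avoids4_map r r' (f : nat -> nat) w :
  {in w &, forall x y, r (f x) (f y) = r' x y} -> avoids4 r (map f w) = avoids4 r' w.
Proof.
move=> fr; apply/avoids4P/avoids4P => av a b c d.
  move=> s4; have := map_subseq f s4 => /= /av.
  have [aw bw cw dw] : [/\ a \in w, b \in w, c \in w & d \in w].
    by split; apply: (mem_subseq s4); rewrite !inE eqxx ?orbT.
  by rewrite !fr.
move=> /subseqP[m sm]; rewrite -map_mask.
have := mask_subseq m w.
case: (mask m w) => [|a' [|b' [|c' [|d' [|e s]]]]] //= s4 [-> -> -> ->].
have [aw bw cw dw] : [/\ a' \in w, b' \in w, c' \in w & d' \in w].
  by split; apply: (mem_subseq s4); rewrite !inE eqxx ?orbT.
by rewrite !fr //; apply: av.
Qed.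

(** A cut is a place where the word splits as a direct sum for [r := ltn], as a skew sum for
    [r := gtn]. *)
Definition cut r w k := allrel r (take k w) (drop k w).
Definition indec r w := ~~ has (cut r w) (iota 1 (size w).-1).

Lemma cut_map r r' (f : nat -> nat) w k :
  {in w &, forall x y, r (f x) (f y) = r' x y} -> cut r (map f w) k = cut r' w k.
Proof.
move=> fr; rewrite /cut -map_take -map_drop allrel_mapl allrel_mapr.
apply/allrelP/allrelP => H x y xw yw; have := H x y xw yw.
  by rewrite fr ?(mem_take xw) ?(mem_drop yw).
by rewrite fr ?(mem_take xw) ?(mem_drop yw).
Qed.

Lemma indec_map r r' (f : nat -> nat) w :
  {in w &, forall x y, r (f x) (f y) = r' x y} -> indec r (map f w) = indec r' w.
Proof.
move=> fr; rewrite /indec size_map; congr (~~ _).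
by apply: eq_in_has => k _; apply: cut_map.
Qed.

Definition separable w := avoids4 ltn w && avoids4 gtn w.

Lemma separable_subseq w w' : subseq w' w -> separable w -> separable w'.
Proof. by move=> sw /andP[a b]; rewrite /separable !(avoids4_subseq sw). Qed.

(* Neither pattern is a direct sum of smaller ones, so no occurrence straddles the cut. *)
Lemma separable_cat u w : allrel ltn u w ->
  separable (u ++ w) = separable u && separable w.
Proof.
move=> uw; apply/idP/idP => [s|/andP[/andP[ul ug] /andP[wl wg]]].
  by rewrite !(separable_subseq _ s) ?prefix_subseq ?suffix_subseq.
have lt x y : x \in u -> y \in w -> x < y by move=> xu yw; apply: (allrelP uw).
have split4 a b c d : subseq [:: a; b; c; d] (u ++ w) ->
    [\/ subseq [:: a; b; c; d] u, subseq [:: a; b; c; d] w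
      | [/\ a \in u, d \in w & (b \in u) || (c \in w)]].
  move=> /subseqP[m sm]; rewrite -(cat_take_drop (size u) m) mask_cat; last first.
    by rewrite size_takel // sm size_cat leq_addr.
  have su := mask_subseq (take (size u) m) u; have sw := mask_subseq (drop (size u) m) w.
  move: su sw; case: (mask _ u) => [|x [|y [|z [|t [|? ?]]]]] su sw /= E.
  - by apply: Or32; rewrite E.
  - apply: Or33; case: E su sw => -> <- su sw.
    by split; rewrite ?[c \in w](mem_subseq sw) ?orbT //
      ?(mem_subseq su) ?(mem_subseq sw) ?inE ?eqxx ?orbT.
  - apply: Or33; case: E su sw => -> -> <- su sw.
    by split; rewrite ?[y \in u](mem_subseq su) //
      ?(mem_subseq su) ?(mem_subseq sw) // !inE eqxx ?orbT.
  - apply: Or33; case: E su sw => -> -> -> <- su sw.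
    by split; rewrite ?[y \in u](mem_subseq su) //
      ?(mem_subseq su) ?(mem_subseq sw) // !inE eqxx ?orbT.
  - by apply: Or31; case: E su => -> -> -> -> _.
  - by apply: Or31; case: E.
apply/andP; split; apply/avoids4P => a b c d /split4[].
- by move/(avoids4P _ _ ul).
- by move/(avoids4P _ _ wl).
- by case=> au dw _; have := lt _ _ au dw; rewrite /=; lia.
- by move/(avoids4P _ _ ug).
- by move/(avoids4P _ _ wg).
- case=> au dw /orP[bu|cw]; first by have := lt _ _ bu dw; rewrite /=; lia.
  by have := lt _ _ au cw; rewrite /=; lia.
Qed.

Lemma cut_first r w : has (cut r w) (iota 1 (size w).-1) ->
  exists k, [/\ 0 < k, k < size w, cut r w k & forall j, 0 < j -> j < k -> ~~ cut r w j].
Proof.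
move=> h; have /ex_minnP[k /and3P[k0 kw ck] mink] :
    exists k, [&& 0 < k, k < size w & cut r w k].
  by case/hasP: h => k; rewrite mem_iota => kw ck; exists k; rewrite ck; lia.
exists k; split=> // j j0 jk; apply/negP => cj.
by have := mink j; rewrite j0 cj (ltn_trans jk kw) leqNgt jk => /(_ isT).
Qed.

Lemma cutW r w k : 0 < k -> k < size w -> cut r w k -> has (cut r w) (iota 1 (size w).-1).
Proof. by move=> k0 kw ck; apply/hasP; exists k => //; rewrite mem_iota; lia. Qed.

(* Let [k] be the first cut of [w]. If the value [x] falls strictly inside [take k w], then
   [take k w], having no [r]-cut, has an [r']-cut, and letters [a] and [b] on either side of
   it, a letter [z] of [drop k w] and [x] form the forbidden pattern. *)
Lemma cut_rcons r r' w x : transitive r -> (forall y z, y != z -> r y z || r z y) ->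
  (forall y z, r' y z = r z y) -> uniq (rcons w x) -> avoids4 r (rcons w x) ->
  (forall k, 1 < k <= size w -> ~~ indec r (take k w) || ~~ indec r' (take k w)) ->
  ~~ indec r w -> ~~ indec r (rcons w x) || ~~ indec r' (rcons w x).
Proof.
move=> rtr rtot r'E uw av IH; rewrite /indec !negbK => /cut_first[k [k0 kw ck mink]].
move: IH; rewrite /indec => IH.
have wE := cat_take_drop k w.
case c: (drop k w) (size_drop k w) => [|z v] szv; first by move: szv => /=; lia.
have x_neq y : y \in w -> y != x.
  by move: uw; rewrite rcons_uniq => /andP[xw _] yw; apply: contraNneq xw => <-.
case: (boolP (all (r^~ x) (take k w))) => [ux|/allPn[a0 a0u Na0]].
  apply/orP; left; apply: (@cutW _ _ k) => //; first by rewrite size_rcons; lia.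
  rewrite /cut -cats1 takel_cat ?drop_cat ?kw 1?ltnW // allrel_catr allrel1r ux andbT.
  exact: ck.
have rxa0 : r x a0.
  by have := rtot _ _ (x_neq _ (mem_take a0u)); rewrite (negPf Na0).
(* If [x] lies before the whole block for [r], transitivity through [a0] puts it before all of [w],
   and [r'] cuts off the last letter. *)
case: (boolP (all (r x) (take k w))) => [xu|/allPn[b0 b0u Nb0]].
  apply/orP; right; apply: (@cutW _ _ (size w)); rewrite ?size_rcons //; first by lia.
  rewrite /cut -cats1 take_size_cat // drop_size_cat // allrel1r.
  apply/allP => y; rewrite r'E -wE mem_cat => /orP[|yv]; first exact: (allP xu).
  by apply: rtr (allP xu _ a0u) (allrelP ck _ _ a0u yv).
have rb0x : r b0 x.
  by have := rtot _ _ (x_neq _ (mem_take b0u)); rewrite (negPf Nb0) orbF.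
have k1 : 1 < k.
  rewrite ltnNge; apply/negP => k1; have k1E : k = 1 by apply/eqP; rewrite eqn_leq k1 k0.
  move: a0u b0u rxa0 rb0x Na0; rewrite k1E; case: (w) => [|y s] //=.
  by rewrite take0 !inE => /eqP-> /eqP-> _ ->.
have kle := ltnW kw.
(* An [r]-cut of the block would be an [r]-cut of [w] before [k], against the minimality of [k];
   only the [r']-cut survives. *)
have /orP[] := IH k (introT andP (conj k1 kle)); rewrite negbK => /cut_first[j [j0 jk cj _]].
  move: jk; rewrite size_takel // => jk; case/negP: (mink j j0 jk).
  apply/allrelP => y y' yt; rewrite -{1}wE drop_cat size_takel // jk mem_cat.
  have yt' : y \in take j (take k w) by rewrite take_takel 1?ltnW.
  move=> /orP[y'd|y'd]; first by apply: (allrelP cj).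
  by apply: (allrelP ck) => //; apply: mem_take yt'.
have uE := cat_take_drop j (take k w).
have [a au1 rxa] : exists2 a, a \in take j (take k w) & r x a.
  move: a0u; rewrite -{1}uE mem_cat => /orP[|a0d]; first by exists a0.
  case tE: (take j (take k w)) (size_takel (ltnW jk)) => [|y s] sz; first by rewrite -sz in j0.
  exists y; first exact: mem_head.
  apply: (rtr a0) => //; rewrite -r'E; apply: (allrelP cj) => //.
  by rewrite tE mem_head.
have [b bu2 rbx] : exists2 b, b \in drop j (take k w) & r b x.
  move: b0u; rewrite -{1}uE mem_cat => /orP[b0t|]; last by exists b0.
  case dE: (drop j (take k w)) (size_drop j (take k w)) => [|y s] sz.
    by move: jk; rewrite -subn_gt0 -sz.
  exists y; first exact: mem_head.
  apply: (rtr b0) => //; rewrite -r'E; apply: (allrelP cj) => //.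
  by rewrite dE mem_head.
have s4 : subseq [:: a; b; z; x] (rcons w x).
  rewrite -cats1 -wE -uE c -!catA -[[:: a; b; z; x]]/([:: a] ++ [:: b] ++ [:: z] ++ [:: x]).
  apply: cat_subseq; first by rewrite sub1seq.
  apply: cat_subseq; first by rewrite sub1seq.
  by rewrite /= eqxx suffix_subseq.
have := avoids4P _ _ av _ _ _ _ s4; rewrite rbx rxa (allrelP ck) //.
- exact: mem_take au1.
- by rewrite c mem_head.
Qed.

(** Induction on the size: the word without its last letter is already a direct or a skew sum, and
    [cut_rcons], used with the two orders in either role, extends this to the whole word. *)
Lemma separable_decomposable w : uniq w -> separable w -> 1 < size w ->
  ~~ indec ltn w || ~~ indec gtn w.
Proof.
have [n] := ubnP (size w); elim: n w => // n IHn w + uw sw w1.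
case/lastP: w uw sw w1 => // w x uw sw; rewrite size_rcons ltnS => w1 wn.
have sub_w k : subseq (take k w) (rcons w x).
  by rewrite -cats1; apply: subseq_trans (take_subseq _ _) (prefix_subseq _ _).
have IH k : 1 < k <= size w -> ~~ indec ltn (take k w) || ~~ indec gtn (take k w).
  move=> /andP[k1 kw]; apply: IHn; rewrite ?size_takel //; first by lia.
  - exact: subseq_uniq (sub_w k) uw.
  - exact: separable_subseq (sub_w k) sw.
have IH' k : 1 < k <= size w -> ~~ indec gtn (take k w) || ~~ indec ltn (take k w).
  by rewrite orbC; apply: IH.
have [lt_tr gt_tr] : transitive ltn /\ transitive gtn by split=> ? ? ? /=; lia.
have [lt_tot gt_tot] : (forall y z, y != z -> ltn y z || ltn z y)
  /\ (forall y z, y != z -> gtn y z || gtn z y) by split=> ? ? /=; lia.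
have /andP[al ag] := sw.
case: (ltnP 1 (size w)) => [w2|w2].
  have := IH (size w); rewrite w2 leqnn take_size => /(_ isT) /orP[] h.
    exact: (cut_rcons lt_tr lt_tot).
  by rewrite orbC; apply: (cut_rcons gt_tr gt_tot).
case: w w1 w2 uw {IH IH' al ag sw sub_w wn} => [|y [|]] //= _ _.
by rewrite /indec /cut /= inE /allrel /= !andbT !orbF !negbK neq_ltn.
Qed.

(** A word cannot have both kinds of cut: the two would compare its first and last letters in
    opposite ways. *)
Lemma indecC w : uniq w -> separable w -> 1 < size w -> indec gtn w = ~~ indec ltn w.
Proof.
move=> uw sw w1; have := separable_decomposable uw sw w1.
case: (boolP (indec ltn w)); case: (boolP (indec gtn w)) => //=.
rewrite /indec !negbK => /cut_first[j [j0 jw cj _]] /cut_first[k [k0 kw ck _]] _.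
case: w {uw sw w1} j0 jw cj k0 kw ck => [|x w] //.
case: j k => [|j] [|k] // _ jw cj _ kw ck.
have lastd i : i < size w -> last x w \in drop i w.
  move=> iw; rewrite -{1}(cat_take_drop i w) last_cat.
  case: (drop i w) (size_drop i w) => [/= ?|y s _]; first by lia.
  by rewrite /= mem_last.
have := allrelP cj x (last x w) (mem_head _ _) (lastd _ jw).
have := allrelP ck x (last x w) (mem_head _ _) (lastd _ kw).
by rewrite /=; lia.
Qed.

End Words.

(** * First cuts and complements *)

Section Enumeration.
Implicit Types (u v w : seq nat) (k n : nat).

Definition separable_words n := [seq w <- permutations (iota 0 n) | separable w].

Lemma mem_separable_words n w :
  (w \in separable_words n) = separable w && perm_eq w (iota 0 n).
Proof. by rewrite mem_filter mem_permutations. Qed.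

Lemma size_separable_word n w : w \in separable_words n -> size w = n.
Proof. by rewrite mem_separable_words => /andP[_ /perm_size]; rewrite size_iota. Qed.

Lemma uniq_separable_word n w : w \in separable_words n -> uniq w.
Proof. by rewrite mem_separable_words => /andP[_ /perm_uniq->]; rewrite iota_uniq. Qed.

Lemma ltn_separable_word n w x : w \in separable_words n -> x \in w -> x < n.
Proof. by rewrite mem_separable_words => /andP[_ /perm_mem->]; rewrite mem_iota. Qed.

Lemma separable_map (f : nat -> nat) w :
  {in w &, {mono f : x y / x < y}} -> separable (map f w) = separable w.
Proof.
move=> fm; rewrite /separable (@avoids4_map ltn ltn) // (@avoids4_map gtn gtn) //.
by move=> x y xw yw; apply: fm.
Qed.

Definition oplus u v := u ++ map (addn (size u)) v.

(** Without a cut, [find] returns the length of its list, so that a nonempty indecomposable word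
    gets the value [size w]. *)
Definition first_cut w := (find (cut ltn w) (iota 1 (size w).-1)).+1.

Lemma first_cut_le w : 0 < size w -> first_cut w <= size w.
Proof.
by move=> w0; rewrite /first_cut (leq_ltn_trans (find_size _ _)) // size_iota; lia.
Qed.

Lemma first_cut_size w : 0 < size w -> (first_cut w == size w) = indec ltn w.
Proof.
case: w => // x w _; rewrite /first_cut /indec has_find size_iota /= eqSS -leqNgt.
by rewrite eqn_leq; have := find_size (cut ltn (x :: w)) (iota 1 (size w)); rewrite size_iota => ->.
Qed.

Lemma cut_first_cut w : first_cut w < size w -> cut ltn w (first_cut w).
Proof.
rewrite /first_cut => lt; have h : has (cut ltn w) (iota 1 (size w).-1).
  by rewrite has_find size_iota; lia.
have := nth_find 0 h; rewrite nth_iota //.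
by move: h; rewrite has_find size_iota.
Qed.

(** Since [u] lies below [v], the cuts of [u ++ v] before position [size u] are exactly those of
    [u], and [size u] is itself a cut. *)
Lemma first_cut_cat u v : 0 < size u -> 0 < size v -> allrel ltn u v ->
  (first_cut (u ++ v) == size u) = indec ltn u.
Proof.
move=> u0 v0 uv; rewrite /first_cut size_cat.
have -> : (size u + size v).-1 = (size u).-1 + size v by lia.
rewrite iotaD find_cat size_iota.
have cutE : {in iota 1 (size u).-1, cut ltn (u ++ v) =1 cut ltn u}.
  move=> j; rewrite mem_iota => ju; have ju' : j < size u by lia.
  rewrite /cut takel_cat 1?ltnW // drop_cat ju' allrel_catr.
  rewrite [X in _ && X](_ : _ = true) ?andbT //.
  by apply/allrelP => x y /mem_take xu yv; apply: (allrelP uv).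
rewrite (eq_in_has cutE) /indec; case: ifP => h /=.
  rewrite (eq_in_find cutE); apply/negbTE; rewrite neq_ltn.
  by move: h; rewrite has_find size_iota; lia.
case: v v0 uv {cutE} => // y v _ uv /=.
have -> : 1 + (size u).-1 = size u by lia.
rewrite /cut take_size_cat // drop_size_cat // uv addn0.
by rewrite prednK // eqxx.
Qed.

Lemma perm_take_cut n k w : k <= n -> perm_eq w (iota 0 n) -> cut ltn w k ->
  perm_eq (take k w) (iota 0 k) /\ perm_eq (drop k w) (iota k (n - k)).
Proof.
move=> kn wn ck; have sw : size w = n by rewrite (perm_size wn) size_iota.
have uw : uniq w by rewrite (perm_uniq wn) iota_uniq.
have mw x : x \in w -> x < n by rewrite (perm_mem wn) mem_iota.
have stk : size (take k w) = k by rewrite size_takel ?sw.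
have tk : perm_eq (take k w) (iota 0 k).
  have sub : {subset take k w <= iota 0 k}.
    move=> x xt; rewrite mem_iota /= add0n ltnNge; apply/negP => kx.
    (* All [n - k] letters after the cut exceed [x], but only [n - x - 1] values do, which is too
       few when [k <= x]. *)
    have : size (drop k w) <= size (iota x.+1 (n - x.+1)).
      apply: uniq_leq_size; first by rewrite drop_uniq.
      move=> y yd; rewrite mem_iota; have := allrelP ck _ _ xt yd.
      by have := mw _ (mem_drop yd); rewrite /=; lia.
    by rewrite size_drop size_iota sw; have := mw _ (mem_take xt); lia.
  have [|_ eq_s] := uniq_min_size (take_uniq k uw) sub; first by rewrite stk size_iota.
  by apply: uniq_perm => //; rewrite ?take_uniq ?iota_uniq //.
split=> //; rewrite -(perm_cat2l (take k w)) cat_take_drop (permPl wn).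
by rewrite -{1}(subnKC kn) iotaD add0n perm_cat2r perm_sym.
Qed.

Lemma allrel_oplus u v : {in u, forall x, x < size u} ->
  allrel ltn u (map (addn (size u)) v).
Proof.
move=> ub; apply/allrelP => x y /ub xu /mapP[z _ ->].
by rewrite /= (leq_trans xu) ?leq_addr.
Qed.

(** Choosing the first cut makes the decomposition unique: it forces the left summand to be
    indecomposable and leaves the right one free. *)
Lemma separable_words_first_cut n k : 0 < k < n ->
  perm_eq [seq w <- separable_words n | first_cut w == k]
    [seq oplus u v | u <- [seq u <- separable_words k | indec ltn u],
                     v <- separable_words (n - k)].
Proof.
move=> /andP[k0 kn]; have nk0 : 0 < n - k by rewrite subn_gt0.
apply: uniq_perm => [||w].
- by rewrite !filter_uniq ?permutations_uniq.
- apply: allpairs_uniq; rewrite ?filter_uniq ?permutations_uniq //.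
  move=> [u v] [u' v'] /allpairsP[[? ?]] /= [+ _] [-> _].
  rewrite mem_filter => /andP[_ /size_separable_word su].
  move=> /allpairsP[[? ?]] /= [+ _] [-> _].
  rewrite mem_filter => /andP[_ /size_separable_word su'].
  rewrite /oplus su su' => /eqP; rewrite eqseq_cat ?su ?su' // => /andP[/eqP-> /eqP].
  by move/(inj_map (@addnI k)) ->.
rewrite mem_filter mem_separable_words; apply/idP/allpairsP; last first.
  case=> [[u v]] /= []; rewrite mem_filter => /andP[iu uk] vk ->.
  have su := size_separable_word uk; have sv := size_separable_word vk.
  have uv : allrel ltn u (map (addn (size u)) v).
    by apply: allrel_oplus => // x /(ltn_separable_word uk); rewrite su.
  have -> /= : first_cut (oplus u v) == k.
    by rewrite -su first_cut_cat // ?size_map ?su ?sv.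
  move: uk vk; rewrite !mem_separable_words => /andP[spu pu] /andP[spv pv].
  rewrite separable_cat // spu separable_map ?spv /=; last by move=> *; rewrite ltn_add2l.
  rewrite /oplus su -{1}(subnKC (ltnW kn)) iotaD add0n; apply: perm_cat => //.
  by rewrite -{2}[k]addn0 iotaDl perm_map.
move=> /andP[/eqP fw /andP[spw pw]].
have sw : size w = n by rewrite (perm_size pw) size_iota.
have ck : cut ltn w k by rewrite -fw; apply: cut_first_cut; rewrite fw sw.
have [pt pd] := perm_take_cut (ltnW kn) pw ck.
have st : size (take k w) = k by rewrite size_takel // sw ltnW.
(* The letters after the cut are at least [k], so truncated subtraction of [k] loses nothing. *)
have dE : drop k w = map (addn k) (map (subn^~ k) (drop k w)).
  rewrite -map_comp -[LHS]map_id; apply/eq_in_map => x xd /=.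
  by move: xd; rewrite (perm_mem pd) mem_iota => /andP[/subnKC].
exists (take k w, map (subn^~ k) (drop k w)); rewrite /= mem_filter !mem_separable_words.
have wE : w = oplus (take k w) (map (subn^~ k) (drop k w)).
  by rewrite /oplus st -dE cat_take_drop.
split=> //.
- rewrite pt (separable_subseq (take_subseq _ _) spw) !andbT.
  by rewrite -(@first_cut_cat _ (drop k w)) ?cat_take_drop ?fw ?st ?size_drop ?sw ?eqxx.
- have := separable_subseq (drop_subseq w k) spw.
  rewrite {1}dE separable_map => [->|x y _ _]; last by rewrite ltn_add2l.
  have iE : iota k (n - k) = map (addn k) (iota 0 (n - k)) by rewrite -iotaDl addn0.
  by move: pd; rewrite {1}dE iE => /(perm_map_inj (@addnI k)) ->; rewrite andbT.
Qed.

Definition complement n w := map (fun x => n.-1 - x) w.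

Lemma complement_mono n w : w \in separable_words n ->
  {in w &, forall x y, (n.-1 - x < n.-1 - y) = (y < x)}.
Proof.
by move=> wn x y /(ltn_separable_word wn) xn /(ltn_separable_word wn) yn; lia.
Qed.

(** Complementation is an involution exchanging 3142 and 2413. *)
Lemma separable_words_complement n :
  perm_eq (map (complement n) (separable_words n)) (separable_words n).
Proof.
have sub w : w \in separable_words n -> complement n w \in separable_words n.
  move=> wn; have mono := complement_mono wn.
  have el : avoids4 ltn (complement n w) = avoids4 gtn w by apply: avoids4_map.
  have eg : avoids4 gtn (complement n w) = avoids4 ltn w.
    by apply: avoids4_map => x y xw yw; apply: mono.
  rewrite mem_separable_words /separable el eg.
  move: (wn); rewrite mem_separable_words /separable => /andP[/andP[-> ->] pw] /=.
  apply: (perm_trans (perm_map _ pw)).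
  apply: uniq_perm; rewrite ?iota_uniq //.
    by rewrite map_inj_in_uniq ?iota_uniq // => x y; rewrite !mem_iota; lia.
  move=> x; rewrite mem_iota; apply/mapP/idP => [[y]|xn].
    by rewrite mem_iota => yn ->; lia.
  by exists (n.-1 - x); rewrite ?mem_iota; lia.
have invol : {in separable_words n, involutive (complement n)}.
  move=> w wn; rewrite /complement -map_comp -[RHS]map_id; apply/eq_in_map => x xw /=.
  by have := ltn_separable_word wn xw; lia.
apply: uniq_perm; rewrite ?filter_uniq ?permutations_uniq //.
  rewrite map_inj_in_uniq ?filter_uniq ?permutations_uniq //.
  by move=> x y xn yn e; rewrite -(invol x) // e invol.
move=> w; apply/mapP/idP => [[v vn ->]|wn]; first exact: sub.
by exists (complement n w); [apply: sub | rewrite invol].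
Qed.

End Enumeration.

Local Open Scope ring_scope.

(** * Power series modulo a power of the variable *)

Section PowerSeries.
Variable R : comNzRingType.
Implicit Types p q u z : {poly R}.

(** The quotient is explicit so that congruences can be combined by exhibiting cofactors and calling
    [ring]. *)
Definition eqXn N p q := exists k, p - q = k * 'X^N.

Lemma eqXn_coef N p q : (forall i, (i < N)%N -> p`_i = q`_i) -> eqXn N p q.
Proof.
move=> pq; exists (drop_poly N (p - q)).
rewrite -{1}(poly_take_drop N (p - q)) [take_poly _ _](_ : _ = 0) ?add0r //.
by apply/polyP=> i; rewrite coef_take_poly coef0 coefB; case: ltnP => // /pq->; rewrite subrr.
Qed.

Lemma coef_eqXn N p q i : eqXn N p q -> (i < N)%N -> p`_i = q`_i.
Proof.
by case=> k pq lt_iN; apply/eqP; rewrite -subr_eq0 -coefB pq coefMXn lt_iN.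
Qed.

(* [1 - u] is a unit modulo ['X^N], with inverse the geometric sum of the powers of [u]. *)
Lemma eqXn_cancel N (u p q : {poly R}) : u`_0 = 0 ->
  eqXn N ((1 - u) * p) ((1 - u) * q) -> eqXn N p q.
Proof.
move=> u0 [k pq].
have [v uE] : exists v, u = v * 'X.
  exists (drop_poly 1 u); rewrite -{1}(poly_take_drop 1 u) [take_poly _ _](_ : _ = 0) ?add0r //.
  by apply/polyP=> i; rewrite coef_take_poly coef0; case: i => //.
exists ((\sum_(i < N) u ^+ i) * k + v ^+ N * (p - q)).
have geo : 1 = (1 - u) * (\sum_(i < N) u ^+ i) + v ^+ N * 'X^N.
  have := subrX1 u N; rewrite -exprMn -uE -[1 - u]opprB mulNr => <-; ring.
rewrite -[LHS]mul1r {1}geo.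
transitivity ((\sum_(i < N) u ^+ i) * ((1 - u) * p - (1 - u) * q) + v ^+ N * 'X^N * (p - q)).
  ring.
by rewrite pq; ring.
Qed.

(* Here [S = (p q; r s)] and [U = (1 + q) + (1 + r) - (1 + q) (1 + r)]. Modulo the system
   [s U = z (1 + q) (1 + r)], [p = t s] and, with [T = t s^2],
   [(1 + q) (1 - T) = U (1 + a s)], [(1 + r) (1 - T) = U (1 + b s)]; substituting the last two
   in the definition of [U] and cancelling [U] and [1 - T] gives the cubic. *)
Lemma cubic_of_system N (z a b t x y v w p q r s : {poly R}) :
  p`_0 = 0 -> q`_0 = 0 -> r`_0 = 0 -> s`_0 = 0 ->
  eqXn N x (z * a + v * s) -> eqXn N y (z + w * s) ->
  eqXn N v (z * t + x * p) -> eqXn N w (z * b + y * p) ->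
  eqXn N q (x * (1 + q)) -> eqXn N s (y * (1 + q)) ->
  eqXn N p (v * (1 + r)) -> eqXn N r (w * (1 + r)) ->
  eqXn N s (z * (1 + (a + b) * s + t * s ^+ 2) + t * s ^+ 3).
Proof.
move=> p0 q0 r0 s0 [k1 e1] [k2 e2] [k3 e3] [k4 e4] [k5 e5] [k6 e6] [k7 e7] [k8 e8].
(* [1 - q * r] equals [al + be - al * be]; this form shows the constant term 1 that allows
   cancellation. *)
pose al := 1 + q; pose be := 1 + r; pose U := 1 - q * r.
have qr0 : (q * r)`_0 = 0 by rewrite coef0M q0 mul0r.
have T0 : (t * s ^+ 2)`_0 = 0 by rewrite expr2 !coef0M s0 !mulr0.
(* Here and in the next steps, the witness combines the known quotients with the same multipliers as
   the congruences in the [transitivity] step. *)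
have [kA eA] : eqXn N (s * U) (z * al * be).
  exists (al * be * k2 + be * k6 - al * s * k8).
  transitivity (al * be * (y - (z + w * s)) + be * (s - y * (1 + q))
                - al * s * (r - w * (1 + r))); first by rewrite /U /al /be; ring.
  by rewrite e2 e6 e8; ring.
have [kC eC] : eqXn N p (t * s).
  apply: (eqXn_cancel qr0); rewrite -/U.
  exists (al * be * k3 - be * p * k5 + al * k7 - t * kA).
  transitivity (al * be * (v - (z * t + x * p)) - be * p * (q - x * (1 + q))
               + al * (p - v * (1 + r)) - t * (s * U - z * al * be)).
    by rewrite /U /al /be; ring.
  by rewrite e3 e5 e7 eA; ring.
have [ka ea] : eqXn N (al * (1 - t * s ^+ 2)) (U * (1 + a * s)).
  exists (al * be * k1 + be * k5 - al * s * k7 + al * s * kC - a * kA).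
  transitivity (al * be * (x - (z * a + v * s)) + be * (q - x * (1 + q))
     - al * s * (p - v * (1 + r)) + al * s * (p - t * s) - a * (s * U - z * al * be)).
    by rewrite /U /al /be; ring.
  by rewrite e1 e5 e7 eC eA; ring.
have [kb eb] : eqXn N (be * (1 - t * s ^+ 2)) (U * (1 + b * s)).
  exists (al * be * k4 + al * k8 - be * p * k6 + be * s * kC - b * kA).
  transitivity (al * be * (w - (z * b + y * p)) + al * (r - w * (1 + r))
     - be * p * (s - y * (1 + q)) + be * s * (p - t * s) - b * (s * U - z * al * be)).
    by rewrite /U /al /be; ring.
  by rewrite e4 e8 e6 eC eA; ring.
pose T := t * s ^+ 2; rewrite -/T in ea eb T0.
(* This is [U = al + be - al * be] multiplied by [(1 - T) ^+ 2], after substitution and cancellation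
   of one factor [U]. *)
have [kD eD] : eqXn N (U * (1 + a * s) * (1 + b * s)) ((1 - T) * (1 + (a + b) * s + T)).
  apply: (eqXn_cancel qr0); rewrite -/U.
  exists ((1 - T) * (ka + kb) - be * (1 - T) * ka - U * (1 + a * s) * kb).
  transitivity ((1 - T) * ((al * (1 - T) - U * (1 + a * s)) + (be * (1 - T) - U * (1 + b * s)))
    - be * (1 - T) * (al * (1 - T) - U * (1 + a * s))
    - U * (1 + a * s) * (be * (1 - T) - U * (1 + b * s))).
    by rewrite /U /al /be; ring.
  by rewrite ea eb; ring.
(* Substituting for [al] and [be] in [eA] produces [(1 + a * s) * (1 + b * s)], which [eD] trades
   for an expression in [a + b]. *)
have [kE eE] : eqXn N (s * (1 - T)) (z * (1 + (a + b) * s + T)).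
  apply: (eqXn_cancel T0); apply: (eqXn_cancel qr0); rewrite -/U.
  exists ((1 - T) ^+ 2 * kA + z * (be * (1 - T) * ka + U * (1 + a * s) * kb) + z * U * kD).
  transitivity ((1 - T) ^+ 2 * (s * U - z * al * be)
    + z * (be * (1 - T) * (al * (1 - T) - U * (1 + a * s))
            + U * (1 + a * s) * (be * (1 - T) - U * (1 + b * s)))
    + z * U * (U * (1 + a * s) * (1 + b * s) - (1 - T) * (1 + (a + b) * s + T))).
    by ring.
  by rewrite eA ea eb eD; ring.
by exists kE; rewrite -eE /T; ring.
Qed.

(** The difference of the two equations factors as [(1 - u) * (s - s')], where [u] has no constant
    term. *)
Lemma cubic_uniq N (z c t s s' : {poly R}) :
  z`_0 = 0 -> s`_0 = 0 -> s'`_0 = 0 ->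
  eqXn N s (z * (1 + c * s + t * s ^+ 2) + t * s ^+ 3) ->
  eqXn N s' (z * (1 + c * s' + t * s' ^+ 2) + t * s' ^+ 3) ->
  eqXn N s s'.
Proof.
move=> z0 s0 s'0 [k e] [k' e'].
pose u := z * (c + t * (s + s')) + t * (s ^+ 2 + s * s' + s' ^+ 2).
have u0 : u`_0 = 0 by rewrite coefD !coef0M z0 !coefD !expr2 !coef0M s0 s'0; ring.
apply: (eqXn_cancel u0); exists (k - k').
transitivity ((s - (z * (1 + c * s + t * s ^+ 2) + t * s ^+ 3))
  - (s' - (z * (1 + c * s' + t * s' ^+ 2) + t * s' ^+ 3))); first by rewrite /u; ring.
by rewrite e e'; ring.
Qed.

End PowerSeries.

(** * Weighted enumeration of separable words *)

Lemma separable_small w : (size w < 4)%N -> separable w.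
Proof.
move=> w4; suff av r : avoids4 r w by rewrite /separable !av.
by apply/avoids4P => a b c d /size_subseq /= ?; lia.
Qed.

Section Weights.
Variable R : comNzRingType.
Implicit Types (W : bool -> bool -> R) (l r : bool) (w s : seq nat).

(* [W l r] weighs a letter; [l] (resp. [r]) tells whether its left (resp. right)
   neighbour is larger, so that valleys, peaks, double ascents and double descents are
   [W true true], [W false false], [W false true] and [W true false].
   The outer arguments [l], [r] play the role of the conventions on pi_0 and pi_(n+1). *)
Fixpoint weight_cons W l r x s : R :=
  if s is y :: s' then W l (x < y)%N * weight_cons W (~~ (x < y)%N) r y s' else W l r.

Definition weight W l r w : R := if w is x :: s then weight_cons W l r x s else 0.

(** Complementing a word turns larger neighbours into smaller ones; this is the weight seen after
    that exchange. *)
Definition opp_weight W l r := W (~~ l) (~~ r).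

Lemma weight_cons_cat W l r x s y s' :
  weight_cons W l r x (s ++ y :: s') =
  weight_cons W l (last x s < y)%N x s * weight_cons W (~~ (last x s < y)%N) r y s'.
Proof. by elim: s l x => //= z s IHs l x; rewrite IHs mulrA. Qed.

(** The junction is an ascent: the last letter of [u] has a larger right neighbour, the first of [v]
    a smaller left one. *)
Lemma weight_cat W l r u v : (0 < size u)%N -> (0 < size v)%N -> allrel ltn u v ->
  weight W l r (u ++ v) = weight W l true u * weight W false r v.
Proof.
case: u v => // x u [|y v] // _ _ uv /=; rewrite weight_cons_cat.
have -> : (last x u < y)%N by apply: (allrelP uv); rewrite ?mem_last ?mem_head.
by [].
Qed.

Lemma weight_map W l r (f : nat -> nat) w :
  {in w &, {mono f : x y / (x < y)%N}} -> weight W l r (map f w) = weight W l r w.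
Proof.
case: w => //= x s; elim: s x l => //= y s IHs x l fm.
rewrite fm ?inE ?eqxx ?orbT // IHs // => a b ai bi; apply: fm; exact: mem_behead.
Qed.

Lemma weight_complement W l r (f : nat -> nat) w : uniq w ->
  {in w &, forall x y, (f x < f y) = (y < x)}%N ->
  weight W l r (map f w) = weight (opp_weight W) (~~ l) (~~ r) w.
Proof.
case: w => //= x s; elim: s x l => [|y s IHs] x l; first by rewrite /opp_weight /= !negbK.
move=> /= /andP[xs us] fm; rewrite fm ?inE ?eqxx ?orbT //.
have xy : (y < x)%N = ~~ (x < y)%N.
  by move: xs; rewrite inE negb_or -leqNgt => /andP[xy _]; rewrite ltn_neqAle eq_sym xy.
rewrite IHs //; last by move=> a b ai bi; apply: fm; apply: mem_behead.
by rewrite /opp_weight !negbK xy.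
Qed.

Definition sep_sum W l r n := \sum_(w <- separable_words n) weight W l r w.
Definition indec_sum W l r n :=
  \sum_(w <- separable_words n | indec ltn w) weight W l r w.

(** The words are sorted by [first_cut]: the value [n] gives the indecomposable ones, each [k < n] a
    product. *)
Lemma sep_sum_cut W l r n : (0 < n)%N ->
  sep_sum W l r n =
  indec_sum W l r n + \sum_(1 <= k < n) indec_sum W l true k * sep_sum W false r (n - k).
Proof.
move=> n0; transitivity (\sum_(1 <= k < n.+1)
    \sum_(w <- separable_words n | first_cut w == k) weight W l r w).
  under eq_bigr do rewrite big_mkcond.
  rewrite exchange_big /=; apply: eq_big_seq => w wn.
  have sw := size_separable_word wn; rewrite -big_mkcond /=.
  under eq_bigl do rewrite eq_sym.
  by rewrite big_nat1_eq ltnS -sw first_cut_le ?sw.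
rewrite big_nat_recr //= addrC; congr (_ + _).
  rewrite /indec_sum big_seq_cond [RHS]big_seq_cond; apply: eq_bigl => w.
  case: (boolP (w \in _)) => //= wn.
  by rewrite -(size_separable_word wn) first_cut_size ?(size_separable_word wn).
apply: eq_big_nat => k kn; rewrite -big_filter (perm_big _ (separable_words_first_cut kn)) /=.
rewrite big_allpairs_dep big_filter /indec_sum mulr_suml big_seq_cond [RHS]big_seq_cond.
apply: eq_bigr => u /andP[uk _]; rewrite mulr_sumr; apply: eq_big_seq => v vk.
have [su sv] := (size_separable_word uk, size_separable_word vk).
rewrite /oplus weight_cat ?size_map ?su ?sv //; try lia.
  by rewrite (@weight_map _ _ _ (addn k)) // => x y _ _; rewrite ltn_add2l.
by rewrite -{1}su; apply: allrel_oplus => // x /(ltn_separable_word uk); rewrite su.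
Qed.

Lemma sum_complement W l r n (P P' : pred (seq nat)) :
  {in separable_words n, forall w, P (complement n w) = P' w} ->
  \sum_(w <- separable_words n | P w) weight W l r w =
  \sum_(w <- separable_words n | P' w) weight (opp_weight W) (~~ l) (~~ r) w.
Proof.
move=> PP'; rewrite -(perm_big _ (separable_words_complement n)) /= big_map.
rewrite big_seq_cond [RHS]big_seq_cond; apply: eq_big => w.
  by case: (boolP (w \in _)) => //= wn; rewrite PP'.
move=> /andP[wn _]; apply: weight_complement; first exact: uniq_separable_word wn.
exact: complement_mono.
Qed.

Lemma sep_sum_complement W l r n :
  sep_sum W l r n = sep_sum (opp_weight W) (~~ l) (~~ r) n.
Proof. exact: sum_complement. Qed.

(** The first term takes the words that are not direct sums; the others are not skew sums, so their
    complements make up the second term. *)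
Lemma sep_sum_indec W l r n : (1 < n)%N ->
  sep_sum W l r n = indec_sum W l r n + indec_sum (opp_weight W) (~~ l) (~~ r) n.
Proof.
move=> n1; rewrite /sep_sum (bigID (indec ltn)) /=; congr (_ + _).
apply: sum_complement => w wn; have mono := complement_mono wn.
have -> : indec ltn (complement n w) = indec gtn w by apply: indec_map.
rewrite indecC ?negbK ?(uniq_separable_word wn) ?(size_separable_word wn) //.
by move: wn; rewrite mem_separable_words => /andP[].
Qed.

Lemma separable_words0 : separable_words 0 = [:: [::]].
Proof. by rewrite /separable_words /= separable_small. Qed.

Lemma separable_words1 : separable_words 1 = [:: [:: 0%N]].
Proof. by rewrite /separable_words /= separable_small. Qed.

(** [sep_sum_indec] for [W] and [sep_sum_cut] for [opp_weight W] compute the same sum, and the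
    indecomposable sum of [opp_weight W] cancels. *)
Lemma indec_sum_cut W l n : (1 < n)%N ->
  indec_sum W l true n = \sum_(1 <= k < n)
    indec_sum (opp_weight W) (~~ l) true k * sep_sum (opp_weight W) false false (n - k).
Proof.
move=> n1; have := sep_sum_indec W l true n1.
rewrite sep_sum_complement (@sep_sum_cut (opp_weight W)) ?(ltnW n1) //= addrC.
by move/addIr.
Qed.

Definition ser N (f : nat -> R) : {poly R} := \poly_(i < N) f i.

Lemma coef_ser N f i : (i < N)%N -> (ser N f)`_i = f i.
Proof. by move=> iN; rewrite coef_poly iN. Qed.

Lemma coef_serM N f g n : f 0%N = 0 -> g 0%N = 0 -> (n < N)%N ->
  (ser N f * ser N g)`_n = \sum_(1 <= k < n) f k * g (n - k)%N.
Proof.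
move=> f0 g0 nN; rewrite coefM -(big_mkord predT (fun k => (ser N f)`_k * (ser N g)`_(n - k))) /=.
rewrite big_ltn // coef_ser ?(leq_ltn_trans _ nN) // f0 mul0r add0r.
case: n nN => [|n] nN; first by rewrite !big_geq.
rewrite big_nat_recr //= subnn [(ser N g)`_0]coef_ser ?(leq_ltn_trans _ nN) // g0 mulr0 addr0.
by apply: eq_big_nat => k kn; rewrite !coef_ser //; lia.
Qed.

Lemma sep_sum0 W l r : sep_sum W l r 0 = 0.
Proof. by rewrite /sep_sum separable_words0 big_seq1. Qed.

Lemma indec_sum0 W l r : indec_sum W l r 0 = 0.
Proof. by rewrite /indec_sum separable_words0 big_mkcond big_seq1. Qed.

Lemma indec_sum1 W l r : indec_sum W l r 1 = W l r.
Proof. by rewrite /indec_sum separable_words1 big_cons big_nil /= addr0. Qed.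

Lemma ser_sep_sum W l N : eqXn N (ser N (sep_sum W l true))
  (ser N (indec_sum W l true) * (1 + ser N (sep_sum W false true))).
Proof.
apply: eqXn_coef => i iN; rewrite mulrDr mulr1 coefD coef_serM ?sep_sum0 ?indec_sum0 //.
rewrite !coef_ser //; case: i iN => [|i] iN; last by rewrite sep_sum_cut.
by rewrite sep_sum0 indec_sum0 add0r big_geq.
Qed.

(** [indec_sum_cut] starts at size 2; the one-letter word, of weight [W l true], accounts for the
    term in ['X]. *)
Lemma ser_indec_sum W l N : eqXn N (ser N (indec_sum W l true))
  ('X * (W l true)%:P +
   ser N (indec_sum (opp_weight W) (~~ l) true) * ser N (sep_sum W true true)).
Proof.
apply: eqXn_coef => i iN; rewrite coefD coefMC coefX coef_serM ?sep_sum0 ?indec_sum0 //.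
rewrite !coef_ser //; case: i iN => [|[|i]] iN.
- by rewrite indec_sum0 mul0r add0r big_geq.
- by rewrite indec_sum1 mul1r big_geq // addr0.
rewrite indec_sum_cut // mul0r add0r; apply: eq_bigr => k _.
by rewrite [sep_sum W _ _ _]sep_sum_complement.
Qed.

Lemma weight_ext W W' l r w : W =2 W' -> weight W l r w = weight W' l r w.
Proof.
case: w => //= x s WW'; elim: s x l => [|y s IHs] x l /=; first exact: WW'.
by rewrite WW' IHs.
Qed.

Lemma ser_ext N (f g : nat -> R) : f =1 g -> ser N f = ser N g.
Proof. by move=> fg; apply/polyP => i; rewrite !coef_poly fg. Qed.

(** In [cubic_of_system], [s], [p], [q], [r] become the sums for the ends [true true],
    [false false], [false true], [true false], and [x], [y], [v], [w] the indecomposable sums of [W]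
    and [opp_weight W] with right end [true]. *)
Lemma cubic_sep_sum W N : W true true = 1 -> let s := ser N (sep_sum W true true) in
  eqXn N s ('X * (1 + (W false true + W true false)%:P * s + (W false false)%:P * s ^+ 2)
            + (W false false)%:P * s ^+ 3).
Proof.
move=> W1 s; have oppK : opp_weight (opp_weight W) =2 W.
  by move=> l r; rewrite /opp_weight !negbK.
have indecK l r : indec_sum (opp_weight (opp_weight W)) l r =1 indec_sum W l r.
  by move=> n; apply: eq_bigr => w _; apply: weight_ext.
have sepC l r : sep_sum (opp_weight W) l r =1 sep_sum W (~~ l) (~~ r).
  by move=> n; rewrite [RHS]sep_sum_complement !negbK.
have e1 := ser_indec_sum W false N.
have e2 := ser_indec_sum W true N; rewrite W1 mulr1 in e2.
have e3 := ser_indec_sum (opp_weight W) true N.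
have e4 := ser_indec_sum (opp_weight W) false N.
rewrite (ser_ext _ (indecK _ _)) (ser_ext _ (sepC _ _)) in e3.
rewrite (ser_ext _ (indecK _ _)) (ser_ext _ (sepC _ _)) in e4.
have e5 := ser_sep_sum W false N.
have e6 := ser_sep_sum W true N.
have e7 := ser_sep_sum (opp_weight W) true N.
have e8 := ser_sep_sum (opp_weight W) false N.
rewrite !(ser_ext _ (sepC _ _)) in e7.
rewrite !(ser_ext _ (sepC _ _)) in e8.
have ser0 l r : (ser N (sep_sum W l r))`_0 = 0.
  by rewrite coef_poly sep_sum0 if_same.
rewrite polyCD; apply: (cubic_of_system _ _ _ _ e1 e2 e3 e4 e5 e6 e7 e8); exact: ser0.
Qed.

(** Both series solve the same cubic, so [cubic_uniq] applies; the order [n.+1] keeps the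
    coefficient of index [n]. *)
Lemma sep_sum_double W W' n : W true true = 1 -> W' true true = 1 ->
  W false false = W' false false ->
  W false true + W true false = W' false true + W' true false ->
  sep_sum W true true n = sep_sum W' true true n.
Proof.
move=> W1 W'1 peak double.
have e := cubic_sep_sum n.+1 W1; have e' := cubic_sep_sum n.+1 W'1.
rewrite /= -peak -double in e e'.
have ser0 V : (ser n.+1 (sep_sum V true true))`_0 = 0 by rewrite coef_ser // sep_sum0.
have /coef_eqXn/(_ (ltnSn n)) := cubic_uniq (coefX _ 0) (ser0 W) (ser0 W') e e'.
by rewrite !coef_ser.
Qed.

End Weights.

(** * Permutations and their statistics *)

Section PermWords.
Variable n : nat.
Implicit Types pi : 'S_n.
Local Open Scope nat_scope.

Definition word pi : seq nat := [seq val (pi j) | j <- enum 'I_n].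

Lemma size_word pi : size (word pi) = n.
Proof. by rewrite size_map size_enum_ord. Qed.

Lemma word_inj : injective word.
Proof.
move=> p q /eq_in_map pq; apply/permP => j; apply: val_inj.
by apply: pq; rewrite mem_enum.
Qed.

Lemma perm_word_iota pi : perm_eq (word pi) (iota 0 n).
Proof.
rewrite /word map_comp -val_enum_ord perm_map //; apply: uniq_perm; rewrite ?enum_uniq //.
  by rewrite map_inj_uniq ?enum_uniq //; apply: perm_inj.
move=> i; rewrite mem_enum; apply/mapP; exists ((pi^-1)%g i); rewrite ?mem_enum //.
by rewrite permKV.
Qed.

(** Surjectivity comes from counting: [word] is injective and both lists have n! elements. *)
Lemma words_perms : perm_eq [seq word pi | pi <- enum {: 'S_n}] (permutations (iota 0 n)).
Proof.
have uw : uniq [seq word pi | pi <- enum {: 'S_n}].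
  by rewrite map_inj_uniq ?enum_uniq //; apply: word_inj.
apply: uniq_perm => //; first exact: permutations_uniq.
apply: (uniq_min_size uw _ _).2.
  by move=> _ /mapP[pi _ ->]; rewrite mem_permutations perm_word_iota.
by rewrite size_permutations ?iota_uniq // size_iota size_map -cardE card_Sn.
Qed.

Lemma sorted_enum_ord : sorted (fun i j : 'I_n => i < j) (enum 'I_n).
Proof. by have := iota_ltn_sorted 0 n; rewrite -val_enum_ord sorted_map. Qed.

(** A strictly increasing list is determined by its elements, so it is the filter of the enumeration
    by its own membership. *)
Lemma sorted_subseq_enum_ord (s : seq 'I_n) :
  sorted (fun i j : 'I_n => i < j) s -> subseq s (enum 'I_n).
Proof.
move=> ss; suff -> : s = filter (mem s) (enum 'I_n) by apply: filter_subseq.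
have tr : transitive (fun i j : 'I_n => i < j) by move=> ? ? ? /=; apply: ltn_trans.
apply: (irr_sorted_eq tr) => //; first by move=> i /=; apply: ltnn.
  apply: sorted_filter => //.
  exact: sorted_enum_ord.
by move=> i; rewrite mem_filter mem_enum andbT.
Qed.

Lemma subseq_wordP pi (a b c d : nat) : reflect
  (exists i j k l : 'I_n, [/\ i < j, j < k, k < l &
     [:: a; b; c; d] = [:: val (pi i); val (pi j); val (pi k); val (pi l)]])
  (subseq [:: a; b; c; d] (word pi)).
Proof.
apply: (iffP idP) => [/subseqP[m _]|[i [j [k [l [ij jk kl ->]]]]]].
  rewrite -map_mask; have := mask_subseq m (enum 'I_n).
  have tr : transitive (fun i j : 'I_n => i < j) by move=> ? ? ? /=; apply: ltn_trans.
  case: (mask m _) => [|i [|j [|k [|l [|? ?]]]]] //= s4 E; exists i, j, k, l.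
  by have /and4P[ij jk kl _] := subseq_sorted tr s4 sorted_enum_ord; split.
apply: (@map_subseq _ _ (fun j => val (pi j)) [:: i; j; k; l]).
by apply: sorted_subseq_enum_ord; rewrite /= ij jk kl.
Qed.

(** Occurrences given by position functions become subsequences of length four, the form that
    [avoids4] tests. *)
Lemma contains_patP pi (s0 s1 s2 s3 : nat) (sig := [:: s0; s1; s2; s3]) : reflect
  (exists2 t : seq nat, subseq t (word pi) & size t = 4 /\
     forall p q, p < 4 -> q < 4 -> (nth 0 t p < nth 0 t q) = (nth 0 sig p < nth 0 sig q))
  (contains_pat pi sig).
Proof.
apply: (iffP existsP) => [[f /forallP fP]|[t tw [t4 tP]]].
  have {}fP (a b : 'I_4) : (a < b -> f a < f b) /\
      (pi (f a) < pi (f b)) = (nth 0 sig a < nth 0 sig b).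
    by have /forallP/(_ b)/andP[/implyP ? /eqP] := fP a.
  pose o p := inord p : 'I_4.
  exists [seq val (pi (f (o p))) | p <- iota 0 4].
    apply/subseq_wordP; exists (f (o 0)), (f (o 1)), (f (o 2)), (f (o 3)).
    by split=> //; apply: (fP _ _).1; rewrite !inordK.
  split=> // p q p4 q4; rewrite !(nth_map 0) ?size_iota // !nth_iota // (fP _ _).2.
  by rewrite !inordK.
move: tw tP; case: t t4 => [|a [|b [|c [|d [|? ?]]]]] //= _.
move=> /subseq_wordP[i [j [k [l [ij jk kl [-> -> -> ->]]]]]] tP.
exists [ffun p : 'I_4 => nth i [:: i; j; k; l] p].
apply/forallP => p; apply/forallP => q; rewrite !ffunE; apply/andP; split.
  have [ik jl] := (ltn_trans ij jk, ltn_trans jk kl); have il := ltn_trans ij jl.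
  by apply/implyP; case: p q => [[|[|[|[|?]]]] ?] [[|[|[|[|?]]]] ?].
rewrite -tP //; apply/eqP.
by case: p q => [[|[|[|[|?]]]] ?] [[|[|[|[|?]]]] ?].
Qed.

(** The chain [b < d < a < c] decides every comparison among the four letters, so three tests
    suffice. *)
Lemma avoids_3142 pi : avoids_pat pi [:: 3; 1; 4; 2] = avoids4 ltn (word pi).
Proof.
apply/idP/avoids4P => [av a b c d s4|av].
  apply: contra av => h; apply/contains_patP; exists [:: a; b; c; d] => //; split=> //.
  by move: h => /= h [|[|[|[|?]]]] [|[|[|[|?]]]] //= _ _; lia.
apply/contains_patP => -[t tw [t4 tP]].
move: tw tP; case: t t4 => [|a [|b [|c [|d [|? ?]]]]] //= _ /av /negP abcd tP.
apply: abcd; apply/and3P.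
by split; [exact: tP 1 3 isT isT | exact: tP 3 0 isT isT | exact: tP 0 2 isT isT].
Qed.

Lemma avoids_2413 pi : avoids_pat pi [:: 2; 4; 1; 3] = avoids4 gtn (word pi).
Proof.
apply/idP/avoids4P => [av a b c d s4|av].
  apply: contra av => h; apply/contains_patP; exists [:: a; b; c; d] => //; split=> //.
  by move: h => /= h [|[|[|[|?]]]] [|[|[|[|?]]]] //= _ _; lia.
apply/contains_patP => -[t tw [t4 tP]].
move: tw tP; case: t t4 => [|a [|b [|c [|d [|? ?]]]]] //= _ /av /negP abcd tP.
apply: abcd; apply/and3P.
by split; [exact: tP 3 1 isT isT | exact: tP 0 3 isT isT | exact: tP 2 0 isT isT].
Qed.

Lemma separable_word pi : (pi \in separable_perms n) = separable (word pi).
Proof. by rewrite inE avoids_2413 avoids_3142 andbC. Qed.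

End PermWords.

(** * Descents and double descents read along a word *)

Fixpoint descents (x : nat) s : nat :=
  if s is y :: s' then ((y < x) + descents y s')%N else 0%N.

Fixpoint double_descents (l : bool) (x : nat) s : nat :=
  if s is y :: s' then ((l && (y < x)) + double_descents (y < x) y s')%N else 0%N.

Lemma count_iota_shift (a : pred nat) m : count a (iota 1 m) = count (a \o succn) (iota 0 m).
Proof. by rewrite -[iota 1 m]/(iota (1 + 0)%N m) iotaDl count_map. Qed.

Lemma count_iota_recl (a : pred nat) m :
  count a (iota 0 m.+1) = (a 0 + count (a \o succn) (iota 0 m))%N.
Proof. by rewrite -count_iota_shift. Qed.

(** The default [N] of [nth] acts as the letter +oo at the end: being at least every shifted letter,
    it creates no descent there. *)
Lemma count_descents N x s : all (fun y => y < N)%N (x :: s) ->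
  count (fun i => nth N (map succn (x :: s)) i.+1 < nth N (map succn (x :: s)) i)%N
    (iota 0 (size s).+1) = descents x s.
Proof.
elim: s x => [|y s IHs] x; rewrite [all _ _]/= => /andP[xN sN]; rewrite count_iota_recl.
  by rewrite /= ltnS leqNgt xN.
by rewrite [RHS]/= -(IHs y sN) /= ltnS.
Qed.

Lemma count_double_descents N p x s : all (fun y => y < N)%N (x :: s) ->
  count (fun i => (nth N (p :: map succn (x :: s)) i.+2 < nth N (p :: map succn (x :: s)) i.+1)
      && (nth N (p :: map succn (x :: s)) i.+1 < nth N (p :: map succn (x :: s)) i))%N
    (iota 0 (size s).+1) = double_descents (x.+1 < p)%N x s.
Proof.
elim: s x p => [|y s IHs] x p; rewrite [all _ _]/= => /andP[xN sN]; rewrite count_iota_recl.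
  by rewrite /= ltnS leqNgt xN.
by rewrite [RHS]/= -[(y < x)%N]ltnS -(IHs y x.+1 sN) /= andbC.
Qed.

Section PermStatistics.
Variables (n : nat) (pi : 'S_n).
Hypothesis n_gt0 : (0 < n)%N.

Lemma word_cons : exists x s, word pi = x :: s /\ size s = n.-1.
Proof.
by case: (word pi) (size_word pi) n_gt0 => [|x s] <- // _; exists x, s.
Qed.

Lemma word_ltn x s : word pi = x :: s -> all (fun y => y < n.+1)%N (x :: s).
Proof.
move=> <-; apply/allP => y; rewrite (perm_mem (perm_word_iota pi)) mem_iota => yn.
by rewrite ltnS ltnW.
Qed.

Lemma pvalS i : Defs.pval pi i.+1 = nth n.+1 (map succn (word pi)) i.
Proof. by rewrite /Defs.pval /word -map_comp. Qed.

Lemma des_word x s : word pi = x :: s -> des pi = descents x s.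
Proof.
move=> wE; have sn : (size s).+1 = n by rewrite -(size_word pi) wE.
rewrite -(count_descents (word_ltn wE)) /des count_iota_shift sn.
by apply: eq_count => i; rewrite -wE /comp !pvalS.
Qed.

Lemma dd_word x s : word pi = x :: s -> dd pi = double_descents true x s.
Proof.
move=> wE; have sn : (size s).+1 = n by rewrite -(size_word pi) wE.
have xn : (x.+1 < n.+1)%N.
  have := mem_head x s; rewrite -wE (perm_mem (perm_word_iota pi)) mem_iota => xn.
  by rewrite ltnS.
(* The flag [true] becomes the comparison of the first letter with pi_0, encoded as [n.+1]. *)
rewrite -xn -(count_double_descents _ (word_ltn wE)) /dd count_iota_shift sn.
apply: eq_count => -[|i]; rewrite -wE /comp !pvalS //.

Qed.

End PermStatistics.

(** * The two specialisations of the weight *)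

Section WeightsOfStatistics.
Variables (R : comNzRingType) (t : R).

Definition des_weight (l r : bool) : R := if r then 1 else t.

(** Valleys weigh 1, peaks [t], double ascents [1 + t] and double descents 0; the last two have the
    same sum as under [des_weight]. *)
Definition gamma_weight (l r : bool) : R :=
  if l then r%:R else if r then 1 + t else t.

Lemma weight_descents l x s : uniq (x :: s) ->
  weight_cons des_weight l true x s = t ^+ descents x s.
Proof.
elim: s x l => [|y s IHs] x l //= /andP[xs us]; rewrite IHs // exprD /des_weight.
by move: xs; rewrite inE negb_or => /andP[xy _]; case: ltngtP xy => //; rewrite ?mul1r.
Qed.

(** No two consecutive letters start a descent and the last one starts none; [~~ l] is the extra
    room when [x] itself may start one. *)
Lemma descents_le l x s : uniq (x :: s) -> double_descents l x s = 0%N ->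
  (2 * descents x s <= size s + ~~ l)%N.
Proof.
elim: s x l => [|y s IHs] x l //= /andP[xs us] /eqP.
rewrite addn_eq0 => /andP[d0 /eqP/(IHs _ _ us)]; move: d0.
by case: l; case: (y < x)%N => //= _; lia.
Qed.

(** Without double descents, every descent starts at a peak, and valleys outnumber peaks by one if
    [l] holds, by none otherwise; the exponent of [1 + t] counts the remaining letters, the double
    ascents. *)
Lemma weight_double_descents l x s : uniq (x :: s) ->
  weight_cons gamma_weight l true x s =
  if double_descents l x s == 0%N
  then t ^+ descents x s * (1 + t) ^+ (size s + ~~ l - 2 * descents x s) else 0.
Proof.
elim: s x l => [|y s IHs] x l /=; first by case: l => _; rewrite /gamma_weight /= mul1r.
move=> /andP[xs us]; rewrite IHs //.
have -> : (x < y)%N = ~~ (y < x)%N.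
  by move: xs; rewrite inE negb_or => /andP[xy _]; rewrite -leqNgt ltn_neqAle xy.
rewrite negbK addn_eq0; have := @descents_le (y < x)%N y s us.
case: eqP => [dd0 /(_ dd0)|_ _]; last by rewrite andbF mulr0.
case: l; case: (y < x)%N {dd0} => /= le; rewrite ?mul0r ?mul1r ?add0n ?addn0 //.
- by rewrite addn1.
- rewrite /gamma_weight /= exprS mulrA; congr (_ * _ ^+ _); lia.
- rewrite /gamma_weight /= mulrCA -exprS; congr (_ * _ ^+ _); lia.
Qed.

End WeightsOfStatistics.

(** * The gamma-expansion of [Spoly] *)

Lemma sum_separable_perms (V : nmodType) n (F : seq nat -> V) :
  \sum_(pi in separable_perms n) F (word pi) = \sum_(w <- separable_words n) F w.
Proof.
rewrite big_filter -(perm_big _ (words_perms n)) big_map big_enum_cond /=.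
by apply: eq_bigl => pi; rewrite separable_word.
Qed.

Lemma Spoly_gamma_weight n : (0 < n)%N ->
  Spoly n = \sum_(pi in separable_perms n | dd pi == 0%N)
    'X^(des pi) * (1 + 'X) ^+ (n.-1 - 2 * des pi).
Proof.
move=> n0; transitivity (sep_sum (des_weight 'X : _ -> _ -> {poly int}) true true n).
  rewrite /sep_sum -sum_separable_perms; apply: eq_bigr => pi _.
  have [x [s [wE sn]]] := word_cons pi n0; rewrite (des_word wE) wE /=.
  by rewrite weight_descents // -wE (perm_uniq (perm_word_iota pi)) iota_uniq.
(* Only double ascents and double descents change weight, from [1] and ['X] to [1 + 'X] and [0]. *)
rewrite (@sep_sum_double _ _ (gamma_weight 'X)) //; last first.
  by rewrite /des_weight /gamma_weight /= addr0.
rewrite /sep_sum -sum_separable_perms [RHS]big_mkcondr; apply: eq_bigr => pi _.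
have [x [s [wE sn]]] := word_cons pi n0; rewrite (des_word wE) (dd_word wE) wE /=.
rewrite weight_double_descents ?sn ?addn0 //.
by rewrite -wE (perm_uniq (perm_word_iota pi)) iota_uniq.
Qed.

Lemma des_le_half n (pi : 'S_n) : (0 < n)%N -> dd pi = 0%N -> (des pi <= n.-1./2)%N.
Proof.
move=> n0; have [x [s [wE sn]]] := word_cons pi n0.
rewrite (des_word wE) (dd_word wE) => /descents_le.
rewrite -wE (perm_uniq (perm_word_iota pi)) iota_uniq sn addn0 => /(_ isT).
by lia.
Qed.

Lemma Spoly_gammaS n : (0 < n)%N ->
  Spoly n = \sum_(k < (n.-1)./2.+1)
              (gammaS n k)%:Z *: ('X^k * (1 + 'X) ^+ (n.-1 - 2 * k)).
Proof.
move=> n0; rewrite Spoly_gamma_weight //.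
(* [inord] is faithful on the summands: there [dd pi = 0], and [des_le_half] bounds [des pi]. *)
pose h (pi : 'S_n) : 'I_(n.-1)./2.+1 := inord (des pi).
rewrite (partition_big h predT) //=; apply: eq_bigr => k _.
transitivity (\sum_(pi in [set pi in separable_perms n | (dd pi == 0%N) && (des pi == k)])
   'X^k * (1 + 'X) ^+ (n.-1 - 2 * k) : {poly int}).
  apply: eq_big => [pi|pi /andP[/andP[_ /eqP dd0] /eqP <-]]; last first.
    by rewrite inordK // ltnS des_le_half.
  rewrite [RHS]inE -andbA; congr (_ && _); case: eqP => //= dd0.
  by rewrite -val_eqE /= inordK // ltnS des_le_half.
by rewrite sumr_const -scaler_nat natz.
Qed.

(** * Symmetry and unimodality from gamma-positivity *)

Section GammaBasis.
Implicit Types m k i : nat.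

Definition gamma_basis m k : {poly int} := 'X^k * (1 + 'X) ^+ (m - 2 * k).

Lemma coef_gamma_basis m k i :
  (gamma_basis m k)`_i = if (i < k)%N then 0 else ('C(m - 2 * k, i - k))%:R.
Proof.
rewrite coefXnM; case: ifP => // _; rewrite addrC exprD1n coef_sum.
case: (ltnP (i - k) (m - 2 * k).+1) => ik.
  rewrite (bigD1 (Ordinal ik)) //= coefMn coefXn eqxx big1 ?addr0 // => j.
  by rewrite -val_eqE /= coefMn coefXn eq_sym => /negPf->; rewrite mul0rn.
rewrite bin_small // big1 // => j _; rewrite coefMn coefXn.
by rewrite gtn_eqF ?mul0rn // (leq_trans (ltn_ord j)).
Qed.

Lemma gamma_basis_large m k i : (2 * k <= m)%N -> (m < i)%N -> (gamma_basis m k)`_i = 0.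
Proof.
by move=> km mi; rewrite coef_gamma_basis; case: ifP => // _; rewrite bin_small //; lia.
Qed.

Lemma gamma_basis_sym m k i : (2 * k <= m)%N -> (i <= m)%N ->
  (gamma_basis m k)`_i = (gamma_basis m k)`_(m - i).
Proof.
move=> km im; rewrite !coef_gamma_basis.
case: (ltnP i k) => ik; case: (ltnP (m - i) k) => mik //.
- by rewrite bin_small //; lia.
- by rewrite bin_small //; lia.
by rewrite -bin_sub; [congr ('C(_, _))%:R |]; lia.
Qed.

(** The ratio of the two binomials is [(N - j) / (j + 1)], at least 1 in this range. *)
Lemma bin_incr N j : (2 * j < N)%N -> ('C(N, j) <= 'C(N, j.+1))%N.
Proof.
move=> jN; rewrite -(leq_pmul2l (ltn0Sn j)) mul_bin_left leq_mul2r.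
by apply/orP; right; lia.
Qed.

Lemma gamma_basis_incr m k i : (2 * k <= m)%N -> (2 * i < m)%N ->
  (gamma_basis m k)`_i <= (gamma_basis m k)`_i.+1.
Proof.
move=> km im; rewrite !coef_gamma_basis.
case: (ltnP i k) => ik; first by case: ifP.
by rewrite ltnNge (leqW ik) /= subSn // ler_nat bin_incr //; lia.
Qed.

End GammaBasis.

Lemma gamma_positive_palindromic (p : {poly int}) m : gamma_positive p m -> palindromic p m.
Proof.
case=> g [_ ->]; split=> [|i im].
  apply/leq_sizeP => i mi; rewrite coef_sum big1 // => k _.
  by rewrite coefZ gamma_basis_large ?mulr0 //; have := ltn_ord k; lia.
rewrite !coef_sum; apply: eq_bigr => k _; rewrite !coefZ; congr (_ * _).
by apply: gamma_basis_sym => //; have := ltn_ord k; lia.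
Qed.

(** All basis elements increase up to the common centre [m / 2], hence so does a nonnegative
    combination; symmetry gives the other half. *)
Lemma gamma_positive_unimodal (p : {poly int}) m : gamma_positive p m -> unimodal p.
Proof.
move=> gp; have [/leq_sizeP large sym] := gamma_positive_palindromic gp.
case: gp => g [g0 pE].
have incr i : (2 * i < m)%N -> p`_i <= p`_i.+1.
  move=> im; rewrite pE !coef_sum; apply: ler_sum => k _; rewrite !coefZ ler_wpM2l //.
  by apply: gamma_basis_incr => //; have := ltn_ord k; lia.
exists m./2; split=> i ih; first by apply: incr; lia.
case: (ltnP i m) => im; last first.
  rewrite (large i.+1) //; case: (ltnP m i) => [/large->//|mi].
  (* At index [m] the coefficient equals the constant one by symmetry, and that is nonnegative. *)
  have -> : i = m by lia.
  rewrite sym // subnn pE coef_sum sumr_ge0 // => k _; rewrite coefZ mulr_ge0 //.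
  by rewrite coef_gamma_basis; case: ifP.
rewrite sym // [p`_i]sym ?(ltnW im) //.
case: (ltnP (2 * (m - i.+1)) m) => mi; last first.
  (* This case is contradictory, because [m./2 <= i]; the equation follows from that alone. *)
  by have -> : (m - i.+1 = m - i)%N by lia.
by have := incr _ mi; rewrite subnSK.
Qed.

Theorem theorem1p1 (n : nat) (hn : (1 <= n)%N) :
  Spoly n = \sum_(k < (n.-1)./2.+1)
              (gammaS n k)%:Z *: ('X^k * (1 + 'X) ^+ (n.-1 - 2 * k))
  /\ gamma_positive (Spoly n) n.-1
  /\ palindromic (Spoly n) n.-1
  /\ unimodal (Spoly n).
Proof.
have SE := Spoly_gammaS hn.
have gp : gamma_positive (Spoly n) n.-1 by exists (fun k => (gammaS n k)%:Z).
split=> //; split=> //; split; first exact: gamma_positive_palindromic.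
exact: gamma_positive_unimodal gp.
Qed.
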